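(* For fixed $m\ge 3$ and $n$ sufficiently large in terms of $m$, $\tilde r(m,n)\ge n^{(2-\sqrt2)m-O(1)}$; that is, there is an absolute constant $C$ such that for every integer $m\ge3$ there is $n_0(m)$ with $\tilde r(m,n)\ge n^{(2-\sqrt2)m-C}$ for all integers $n\ge n_0(m)$.
   Context: The $(m,n)$-online Ramsey game is played by two players, Builder and Painter, on an infinite set of initially isolated vertices. Each turn, Builder places an edge between two nonadjacent vertices and Painter immediately paints it red or blue. The online Ramsey number $\tilde r(m,n)$ is the smallest number of turns within which Builder can guarantee the existence of either a red $K_m$ or a blue $K_n$, whatever Painter does. *)

(* Defs.v *)
From mathcomp Require Import all_boot zify.
From mathcomp Require Import boolp.

Set Implicit Arguments.
Unset Strict Implicit.
Unset Printing Implicit Defensive.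

(** Vertices are natural numbers. A turn [((u, v), c)] is the (unordered) edge
    [uv], written as a pair in either order, together with its colour; a history
    is the list of the turns played so far, in chronological order. *)
Definition edge : Type := nat * nat.
Definition history : Type := seq (nat * nat * bool).

Definition red : bool := true.
Definition blue : bool := false.

Definition joined (h : history) (c : bool) (u v : nat) : bool :=
  ((u, v, c) \in h) || ((v, u, c) \in h).

Definition adjacent (h : history) (u v : nat) : bool :=
  joined h red u v || joined h blue u v.

Definition has_mono_clique (h : history) (c : bool) (k : nat) : Prop :=
  exists s : seq nat,
    [/\ uniq s, size s = k & {in s &, forall u v, u != v -> joined h c u v}].

Definition legal_move (h : history) (e : edge) : bool :=
  (e.1 != e.2) && ~~ adjacent h e.1 e.2.

Definition builder_strategy : Type := history -> edge.
Definition painter_strategy : Type := history -> edge -> bool.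

Fixpoint play (B : builder_strategy) (P : painter_strategy) (t : nat) : history :=
  if t is t'.+1 then
    let h := play B P t' in rcons h (B h, P h (B h))
  else [::].

Definition legal_builder (B : builder_strategy) : Prop :=
  forall (P : painter_strategy) (t : nat), legal_move (play B P t) (B (play B P t)).

(** Edges are never removed, so a clique that appears during the first [t] turns
    is still present after turn [t]. *)
Definition builder_guarantees (m n t : nat) : Prop :=
  exists2 B : builder_strategy, legal_builder B &
    forall P : painter_strategy,
      has_mono_clique (play B P t) red m \/ has_mono_clique (play B P t) blue n.

Lemma joinedC h c u v : joined h c u v = joined h c v u.
Proof. by rewrite /joined orbC. Qed.

Lemma clique_cons h c x (A : seq nat) s :
  uniq s -> {subset s <= A} -> x \notin A ->
  {in A, forall u, joined h c x u} ->
  {in s &, forall u v, u != v -> joined h c u v} ->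
  uniq (x :: s) /\ {in x :: s &, forall u v, u != v -> joined h c u v}.
Proof.
move=> us sA xA jA js; split.
  by rewrite /= us andbT; apply: contra xA => /sA.
move=> u v; rewrite !inE => /predU1P[->|us'] /predU1P[->|vs'].
- by rewrite eqxx.
- by move=> _; apply/jA/sA.
- by move=> _; rewrite joinedC; apply/jA/sA.
- exact: js.
Qed.

Lemma ramsey_cliques h m n (S : seq nat) :
  uniq S -> {in S &, forall u v, u != v -> adjacent h u v} ->
  2 ^ (m + n) <= size S ->
  (exists s, [/\ uniq s, {subset s <= S}, size s = m &
     {in s &, forall u v, u != v -> joined h red u v}]) \/
  (exists s, [/\ uniq s, {subset s <= S}, size s = n &
     {in s &, forall u v, u != v -> joined h blue u v}]).
Proof.
move: {2}(m + n) (leqnn (m + n)) => k; elim: k m n S => [|k IH] [|m] [|n] S //.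
all: try by left; exists [::].
all: try by right; exists [::].
move=> lek; case: S => [|x S]; first by rewrite leqNgt expn_gt0.
move=> /= /andP[xS uS] adj szS.
set A := [seq u <- S | joined h red x u]; set B := [seq u <- S | joined h blue x u].
have subA : {subset A <= x :: S} by move=> u; rewrite mem_filter inE => /andP[_ ->]; rewrite orbT.
have subB : {subset B <= x :: S} by move=> u; rewrite mem_filter inE => /andP[_ ->]; rewrite orbT.
have xA : x \notin A by rewrite mem_filter negb_and xS orbT.
have xB : x \notin B by rewrite mem_filter negb_and xS orbT.
have uA : uniq A by exact: filter_uniq.
have uB : uniq B by exact: filter_uniq.
have jA : {in A, forall u, joined h red x u} by move=> u; rewrite mem_filter => /andP[].
have jB : {in B, forall u, joined h blue x u} by move=> u; rewrite mem_filter => /andP[].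
have szAB : size S <= size A + size B.
  rewrite !size_filter -count_predUI; apply: leq_trans (leq_addr _ _).
  rewrite -[X in X <= _]count_predT leq_eqVlt; apply/orP; left; apply/eqP.
  apply: eq_in_count => u uS' /=; apply/esym/adj; rewrite ?inE ?eqxx ?uS' ?orbT //.
  by apply: contraNneq xS => ->.
have adjA : {in A &, forall u v, u != v -> adjacent h u v}.
  by move=> u v /subA uA' /subA; apply: adj.
have adjB : {in B &, forall u v, u != v -> adjacent h u v}.
  by move=> u v /subB uB' /subB; apply: adj.
move: szS; rewrite addSn addnS !expnS => szS.
have [bigA|smallA] := leqP (2 ^ (m + n.+1)) (size A).
  have [|[s [us sA szs js]]|[s [us sA szs js]]] := IH m n.+1 A _ uA adjA bigA.
  - by lia.
  - left; have [us' js'] := clique_cons us sA xA jA js.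
    exists (x :: s); split=> //; last by rewrite /= szs.
    by move=> u /predU1P[->|/sA/subA//]; exact: mem_head.
  - by right; exists s; split=> // u /sA/subA.
have bigB : 2 ^ (m.+1 + n) <= size B.
  by move: smallA; rewrite addnS addSn expnS; lia.
have [|[s [us sB szs js]]|[s [us sB szs js]]] := IH m.+1 n B _ uB adjB bigB.
- by lia.
- by left; exists s; split=> // u /sB/subB.
- right; have [us' js'] := clique_cons us sB xB jB js.
  exists (x :: s); split=> //; last by rewrite /= szs.
  by move=> u /predU1P[->|/sB/subB//]; exact: mem_head.
Qed.

Lemma fresh_vertex (h : history) :
  exists N, forall u v c, (u, v, c) \in h -> u < N.
Proof.
elim: h => [|[[u v] c] h [N hN]]; first by exists 0.
exists (maxn u.+1 N) => u' v' c'; rewrite inE => /predU1P[[-> _ _]|/hN]; lia.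
Qed.

Lemma exists_legal_move (h : history) : exists e, legal_move h e.
Proof.
have [N hN] := fresh_vertex h.
exists (N, N.+1); rewrite /legal_move /adjacent /joined /= neq_ltn leqnn /=.
by apply/negP => /orP[/orP[]|/orP[]] /hN; lia.
Qed.

Lemma joined_rcons h x c u v : joined h c u v -> joined (rcons h x) c u v.
Proof.
by rewrite /joined !mem_rcons !in_cons => /orP[] ->; rewrite !orbT.
Qed.

Lemma adjacent_rcons h x u v : adjacent h u v -> adjacent (rcons h x) u v.
Proof.
by move=> /orP[] /(joined_rcons x) H; rewrite /adjacent H ?orbT.
Qed.

Lemma size_play B P t : size (play B P t) = t.
Proof. by elim: t => //= t IH; rewrite size_rcons IH. Qed.

(** Builder draws a complete graph on [2 ^ (m + n)] vertices. *)
Lemma builder_guarantees_ex (m n : nat) :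
  exists t, `[< builder_guarantees m n t >].
Proof.
pose S := iota 0 (2 ^ (m + n)).
pose L := [seq (u, v) | u <- S, v <- S].
pose B (h : history) := let e := nth (0, 0) L (size h) in
  if legal_move h e then e else xchoose (exists_legal_move h).
exists (size L); apply/asboolP; exists B.
  by move=> P t; rewrite /B; case: ifP => // _; exact: xchooseP.
move=> P.
have adjL t : t <= size L -> forall i, i < t ->
    let e := nth (0, 0) L i in e.1 != e.2 -> adjacent (play B P t) e.1 e.2.
  elim: t => // t IH tL i; rewrite ltnS leq_eqVlt => /predU1P[->|it] e ne.
    rewrite [play _ _ _]/=; have [adj|nadj] := boolP (adjacent (play B P t) e.1 e.2).
      exact: adjacent_rcons.
    have -> : B (play B P t) = e by rewrite /B size_play -/e /legal_move ne nadj.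
    rewrite /adjacent /joined !mem_rcons !in_cons -surjective_pairing.
    by case: (P _ _); rewrite eqxx ?orbT.
  by rewrite /=; apply/adjacent_rcons/IH => //; exact: ltnW.
have adj : {in S &, forall u v, u != v -> adjacent (play B P (size L)) u v}.
  move=> u v uS vS ne.
  have uvL : (u, v) \in L by apply/allpairsP; exists (u, v).
  have := adjL _ (leqnn _) (index (u, v) L); rewrite index_mem uvL nth_index //=.
  exact.
have szS : 2 ^ (m + n) <= size S by rewrite size_iota.
have [[s [us _ szs js]]|[s [us _ szs js]]] := ramsey_cliques (iota_uniq _ _) adj szS.
- by left; exists s.
- by right; exists s.
Qed.

Definition online_ramsey (m n : nat) : nat := ex_minn (builder_guarantees_ex m n).

(* Main.v *)
Require Import Defs.
From mathcomp Require Import all_boot all_order all_algebra.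
From mathcomp Require Import perm zify ring lra.

(** Painter colours each edge red with probability [p = n ^ (1/m - 1)],
    derandomised by conditional expectations. A red [K_m] is named by the times
    at which [c] disjoint edges of it are drawn and by the times at which its
    [m - 2c] other vertices first appear: at most [2 ^ (m - 2c) * N ^ (m - c)]
    names. A vertex is known from the time naming it on, and an edge drawn
    between two known vertices is red with probability [p]. If the matching is
    chosen so that its edges are drawn as early as possible, then no edge at one
    of the [m - 2c] vertices comes too early, and among the four edges joining
    two matching edges at most two do (two disjoint early ones could replace the
    matching edges). So [binom(m, 2) - c (c - 1)] edges have to succeed.
    Taking [c] close to [(1 - 1/sqrt 2) m] gives the exponent; the case [c = 0]
    with colour blue bounds the blue [K_n]. *)

(** * Named vertices and counted edges *)

Definition edges (h : history) : seq edge := [seq x.1 | x <- h].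

Definition endpoint (e : edge) (b : bool) : nat := if b then e.1 else e.2.

Definition edge_at (es : seq edge) (t : nat) : edge := nth (0, 0) es t.

(** The entry [(t, b)] of [L] names an endpoint of the edge drawn at turn [t]. *)
Definition exposed (L : seq (nat * bool)) (es : seq edge) (s v : nat) : bool :=
  has (fun tb => (tb.1 <= s) && (endpoint (edge_at es tb.1) tb.2 == v)) L.

(** Being counted depends on the edges drawn up to turn [s] and on no colours, so it is settled
    before Painter answers at turn [s]. Entries with time [s] itself are allowed, so that a matching
    edge counts as well. *)
Definition counted (L : seq (nat * bool)) (es : seq edge) (s : nat) : bool :=
  exposed L es s (edge_at es s).1 && exposed L es s (edge_at es s).2.

Definition ncounted (L : seq (nat * bool)) (es : seq edge) : nat :=
  count (counted L es) (iota 0 (size es)).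

Definition counted_mono (L : seq (nat * bool)) (col : bool) (h : history) : bool :=
  all (fun s => counted L (edges h) s ==> (nth col [seq x.2 | x <- h] s == col))
    (iota 0 (size h)).

Lemma counted_rcons L es e s : s < size es ->
  counted L (rcons es e) s = counted L es s.
Proof.
move=> ls; have E t : t <= s -> edge_at (rcons es e) t = edge_at es t.
  by move=> ts; rewrite /edge_at nth_rcons (leq_ltn_trans ts ls).
have X v : exposed L (rcons es e) s v = exposed L es s v.
  by apply: eq_has => tb; case: leqP => //= /E ->.
by rewrite /counted !X E.
Qed.

Lemma ncounted_rcons L es e :
  ncounted L (rcons es e) = ncounted L es + counted L (rcons es e) (size es).
Proof.
rewrite /ncounted size_rcons -addn1 iotaD count_cat /= addn0 add0n; congr (_ + _).
by apply: eq_in_count => s; rewrite mem_iota => /counted_rcons.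
Qed.

Lemma counted_mono_rcons L col h e c :
  counted_mono L col (rcons h (e, c)) =
  counted_mono L col h &&
  (counted L (rcons (edges h) e) (size h) ==> (c == col)).
Proof.
rewrite /counted_mono size_rcons -addn1 iotaD all_cat /= andbT add0n; congr (_ && _).
  apply: eq_in_all => s; rewrite mem_iota add0n => /= ls.
  rewrite /edges !map_rcons /= counted_rcons ?size_map //.
  by rewrite nth_rcons size_map ls.
by rewrite /edges !map_rcons /= nth_rcons size_map ltnn eqxx.
Qed.

(** * Legal histories and the turns at which edges are drawn *)

Definition legal_history (h : history) : Prop :=
  forall i j, i <= j < size h ->
    let e := edge_at (edges h) i in let f := edge_at (edges h) j in
    f.1 != f.2 /\ (i < j -> (e != f) && (e != (f.2, f.1))).

Lemma legal_play B P t : legal_builder B -> legal_history (play B P t).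
Proof.
move=> lB; elim: t => [i j|t IH i j]; first by rewrite /= andbF.
rewrite [play _ _ _]/= size_rcons ltnS => /andP[ij]; rewrite leq_eqVlt.
set h := play B P t in IH *.
have E k : k < size h -> edge_at (edges (rcons h (B h, P h (B h)))) k
    = edge_at (edges h) k.
  by move=> lk; rewrite /edge_at /edges map_rcons nth_rcons size_map lk.
have EN : edge_at (edges (rcons h (B h, P h (B h)))) (size h) = B h.
  by rewrite /edge_at /edges map_rcons nth_rcons size_map ltnn eqxx.
case/orP => [/eqP ej|lj].
  case: ej => ej; have := lB P t; rewrite -/h /legal_move => /andP[ne nadj].
  rewrite ej EN; split=> // li; rewrite E //.
  have : nth (0,0,red) h i \in h by apply: mem_nth.
  rewrite /edge_at /edges (nth_map (0,0,red)) //.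
  case: (nth _ h i) => -[u v] c /= hi.
  have adj : adjacent h u v.
    by apply/orP; case: c hi => hi; [left|right]; apply/orP; left; exact: hi.
  apply/andP; split; apply: contra nadj => /eqP e; first by rewrite -e.
  by case: e => <- <-; rewrite /adjacent !(joinedC _ _ v).
by rewrite !E ?(leq_ltn_trans ij lj) //; have := IH i j; rewrite ij lj; apply.
Qed.

(** Equals [size h] when the edge is never drawn. *)
Definition time (h : history) (u v : nat) : nat :=
  find (fun e : edge => (e == (u, v)) || (e == (v, u))) (edges h).

Lemma timeC h u v : time h u v = time h v u.
Proof. by apply: eq_find => e; rewrite orbC. Qed.

Lemma edge_at_time h c u v : joined h c u v ->
  time h u v < size h /\
  (edge_at (edges h) (time h u v) = (u, v) \/ edge_at (edges h) (time h u v) = (v, u)).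
Proof.
move=> J.
have H : has (fun e : edge => (e == (u, v)) || (e == (v, u))) (edges h).
  apply/hasP; case/orP: J => hi; [exists (u, v)|exists (v, u)]; rewrite ?eqxx ?orbT //.
    by apply/mapP; exists (u, v, c).
  by apply/mapP; exists (v, u, c).
split; first by move: H; rewrite has_find /edges size_map.
by case/orP: (nth_find (0,0) H) => /eqP; [left|right].
Qed.

(** A legal history draws each edge only once, so the entry that witnesses [joined] sits at turn
    [s]. *)
Lemma color_at (h : history) c u v s : legal_history h -> s < size h ->
  joined h c u v -> edge_at (edges h) s = (u, v) ->
  nth c [seq x.2 | x <- h] s = c.
Proof.
move=> lh ls J es.
have [k [lk ck ek]] : exists k, [/\ k < size h, nth c [seq x.2 | x <- h] k = c
    & edge_at (edges h) k = (u, v) \/ edge_at (edges h) k = (v, u)].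
  case/orP: J => /(nthP (0,0,red)) [k lk ek]; exists k; split=> //.
  1,3: by rewrite (nth_map (0,0,red)) // ek.
  1,2: by rewrite /edge_at /edges (nth_map (0,0,red)) // ek; auto.
have [ks|sk|<- //] := ltngtP k s.
  have [|_ /(_ ks)] := lh k s; first by rewrite (ltnW ks).
  by rewrite es /=; case: ek => ->; rewrite eqxx ?andbF.
have [|_ /(_ sk)] := lh s k; first by rewrite (ltnW sk).
by rewrite es /=; case: ek => -> /=; rewrite eqxx ?andbF.
Qed.

(** * The earliest matching in a clique *)

(** The vertices of a clique, split into [c] matched pairs and [k] single vertices. *)
Notation slot c k := ('I_c * bool + 'I_k)%type.

Definition pair_time {c k} (tau : nat -> nat -> nat) (w : slot c k -> nat) (i : 'I_c) : nat :=
  tau (w (inl (i, true))) (w (inl (i, false))).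

Lemma pair_timeE {c k} tau (w : slot c k -> nat) i b :
  (forall u v, tau u v = tau v u) ->
  pair_time tau w i = tau (w (inl (i, b))) (w (inl (i, ~~ b))).
Proof. by move=> tauC; case: b => //; rewrite tauC. Qed.

(** Exchange argument on an arrangement that minimises a potential in the pair times: trading the
    partner of [(i, b)] for a single vertex gives the first bound, rematching two pairs gives the
    second. *)
Lemma optimal_arrangement {c k} (tau : nat -> nat -> nat) (w0 : slot c k -> nat) :
  (forall u v, tau u v = tau v u) ->
  exists s : {perm slot c k}, let w := w0 \o s in
    (forall i b j, pair_time tau w i <= tau (w (inl (i, b))) (w (inr j))) /\
    (forall i b i' b', i != i' ->
       maxn (pair_time tau w i) (pair_time tau w i') <=
       maxn (tau (w (inl (i, b))) (w (inl (i', b'))))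
            (tau (w (inl (i, ~~ b))) (w (inl (i', ~~ b'))))).
Proof.
move=> tauC.
(* Any base above 2 makes two smaller powers sum to less than a larger one. *)
pose pot (s : {perm slot c k}) := \sum_(i < c) 3 ^ pair_time tau (w0 \o s) i.
have [s _ smin] := @arg_minnP _ (1%g : {perm slot c k}) predT pot isT.
exists s => w.
have swapE a b : w0 \o (tperm a b * s)%g =1 w \o tperm a b by move=> x /=; rewrite permM.
have neI (i i0 : 'I_c) b b0 : i0 != i -> inl (i, b) != inl (i0, b0) :> slot c k.
  by apply: contraNneq => -[->].
have neB (i i0 : 'I_c) b : inl (i0, ~~ b) != inl (i, b) :> slot c k.
  by apply/eqP => -[_]; case: b.
have neB' (i i0 : 'I_c) b : inl (i0, b) != inl (i, ~~ b) :> slot c k.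
  by rewrite eq_sym neB.
split=> [i b j|i b i' b' ne].
  have := smin (tperm (inl (i, ~~ b)) (inr j) * s)%g isT.
  rewrite /pot (bigD1 i) //= [X in _ <= X](bigD1 i) //=.
  rewrite [X in _ <= _ + X](eq_bigr (fun i0 => 3 ^ pair_time tau w i0)); last first.
    by move=> i0 ne; congr (3 ^ _); rewrite /pair_time !swapE /= !tpermD ?neI.
  rewrite leq_add2r leq_exp2l // => /leq_trans; apply.
  by rewrite (@pair_timeE _ _ _ _ _ b) // !swapE /= tpermL tpermD // neB.
set M := maxn (pair_time _ _ _) _; rewrite leqNgt; apply/negP; rewrite gtn_max => /andP[lt1 lt2].
have ne' : i' != i by rewrite eq_sym.
(* After this swap pair [i] holds the old [(i, b)] and [(i', b')], and pair [i'] the two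
   complementary ends; both new edges are earlier than [M]. *)
have := smin (tperm (inl (i, ~~ b)) (inl (i', b')) * s)%g isT.
rewrite /pot (bigD1 i) //= [X in _ <= X](bigD1 i) //=.
rewrite (bigD1 i') //= [X in _ <= _ + X](bigD1 i') //=.
rewrite [X in _ <= _ + (_ + X)](eq_bigr (fun i0 => 3 ^ pair_time tau w i0)); last first.
  by move=> i0 /andP[ne1 ne2]; congr (3 ^ _); rewrite /pair_time !swapE /= !tpermD ?neI.
rewrite !addnA leq_add2r.
rewrite [X in _ <= 3 ^ X + _ -> _](@pair_timeE _ _ _ _ _ b) //.
rewrite [X in _ <= _ + 3 ^ X -> _](@pair_timeE _ _ _ _ _ b') //.
rewrite !swapE /= tpermL tpermR !tpermD ?neB ?neB' ?neI // => le.
have pw t : t < M -> 3 * 3 ^ t <= 3 ^ M by rewrite -expnS leq_exp2l.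
have := pw _ lt1; have := pw _ lt2.
have : 3 ^ M <= 3 ^ pair_time tau w i + 3 ^ pair_time tau w i'.
  by rewrite /M /maxn; case: ifP => _; rewrite ?leq_addl ?leq_addr.
have : 0 < 3 ^ M by rewrite expn_gt0.
move: le; rewrite /w /=; lia.
Qed.

(** * Counted edges of a monochromatic clique *)

Lemma card_set_pair (S T : finType) (P : S -> T -> bool) (d : nat) :
  (forall x, #|[set y | P x y]| = d) -> #|[set z | P z.1 z.2]| = #|S| * d.
Proof.
move=> cP; rewrite -sum1dep_card -(pair_big_dep xpredT P (fun _ _ => 1)) /=.
under eq_bigr do rewrite sum1dep_card cP.
by rewrite sum_nat_const.
Qed.

(** [Q] holds for at most one of [xy] and the complementary edge [x'y'] joining
    the same two pairs. *)
Lemma card_wasted (c : nat) (Q : 'I_c * bool -> 'I_c * bool -> bool) :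
  (forall x y, x.1 != y.1 -> Q x y -> ~~ Q (x.1, ~~ x.2) (y.1, ~~ y.2)) ->
  #|[set z | (z.1.1 != z.2.1) && Q z.1 z.2]| <= 2 * (c * c.-1).
Proof.
move=> hQ; set W := [set z | _].
pose A := [set z : ('I_c * bool) * ('I_c * bool) | z.1.1 != z.2.1].
have cA : #|A| = (c * 2) * (c.-1 * 2).
  rewrite (@card_set_pair _ _ (fun x y : 'I_c * bool => x.1 != y.1) (c.-1 * 2)).
    by rewrite card_prod card_ord card_bool.
  move=> x; rewrite -[in RHS](card_ord c) -card_bool.
  have -> : [set y : 'I_c * bool | x.1 != y.1] = setX [set~ x.1] setT.
    by apply/setP => y; rewrite !inE andbT eq_sym.
  by rewrite cardsX cardsT cardsC1.
(* [flip] is injective and maps [W] into [A :\: W], so [W] is at most half of [A]. *)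
pose flip (z : ('I_c * bool) * ('I_c * bool)) :=
  ((z.1.1, ~~ z.1.2), (z.2.1, ~~ z.2.2)).
have flipK : involutive flip by case=> -[? ?] [? ?]; rewrite /flip /= !negbK.
have WA : W \subset A by apply/subsetP => z; rewrite !inE => /andP[].
have fW : flip @: W \subset A :\: W.
  apply/subsetP => _ /imsetP[z zW ->]; move: zW; rewrite !inE /= => /andP[ne q].
  by rewrite ne /= andbT; apply: hQ.
have := subset_leq_card fW; rewrite card_imset; last exact: inv_inj.
have := cardsID W A; rewrite (setIidPr WA) cA; lia.
Qed.

(** Names a single vertex by its first edge, so that it is known at the time of every edge at it. *)
Lemma first_occurrence (h : history) c v u : joined h c v u ->
  exists tb : 'I_(size h) * bool, endpoint (edge_at (edges h) tb.1) tb.2 = v /\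
    forall u' c', joined h c' v u' -> tb.1 <= time h v u'.
Proof.
move=> J; pose a (e : edge) := (e.1 == v) || (e.2 == v).
have aE u' c' : joined h c' v u' -> time h v u' < size h /\ a (edge_at (edges h) (time h v u')).
  by move=> /edge_at_time[lt [->|->]]; rewrite /a /= eqxx ?orbT.
have [lt _] := aE _ _ J.
have le u' c' : joined h c' v u' -> find a (edges h) <= time h v u'.
  move=> /aE[_ H]; rewrite leqNgt; apply/negP => /(before_find (0, 0)).
  by rewrite -/(edge_at _ _) H.
have ltf : find a (edges h) < size h by apply: leq_ltn_trans lt; apply: le J.
have : a (edge_at (edges h) (find a (edges h))).
  by apply: nth_find; rewrite has_find /edges size_map.
case/orP => /eqP E; [exists (Ordinal ltf, true)|exists (Ordinal ltf, false)]; split => //=.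
Qed.

(** Both endpoints of the edges at the times [TV.1 i], and one endpoint of each
    edge at the times [(TV.2 j).1]. *)
Definition spec {N c k} (TV : {ffun 'I_c -> 'I_N} * {ffun 'I_k -> 'I_N * bool}) :
    seq (nat * bool) :=
  codom (fun a : slot c k =>
    match a with inl ib => (TV.1 ib.1 : nat, ib.2) | inr j => ((TV.2 j).1 : nat, (TV.2 j).2) end).

(** Pairs are named by their matching edges, single vertices by their first edges. The count runs
    over ordered pairs of slots: at most [2 * (c * c.-1)] of them give uncounted edges, and halving
    yields the loss [c * c.-1]. *)
Lemma clique_spec (h : history) (col : bool) (c k : nat) :
  legal_history h -> 1 < c.*2 + k -> has_mono_clique h col (c.*2 + k) ->
  exists TV : {ffun 'I_c -> 'I_(size h)} * {ffun 'I_k -> 'I_(size h) * bool},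
    counted_mono (spec TV) col h /\
    'C(c.*2 + k, 2) - c * c.-1 <= ncounted (spec TV) (edges h).
Proof.
move=> lh m1 [s [us szs js]].
have cardI : #|{: slot c k}| = c.*2 + k by rewrite card_sum card_prod card_bool !card_ord muln2.
pose w0 (a : slot c k) := nth 0 s (enum_rank a).
have w0s a : w0 a \in s by rewrite mem_nth // szs -cardI.
have w0I : injective w0.
  move=> a b /eqP; rewrite nth_uniq ?szs -?cardI // => /eqP/val_inj; exact: enum_rank_inj.
have [p /=] := optimal_arrangement _ w0 (timeC h).
set w := w0 \o p => -[opt1 opt2].
have ws a : w a \in s by exact: w0s.
have wI : injective w by apply: inj_comp w0I _; exact: perm_inj.
have jw a b : a != b -> joined h col (w a) (w b).
  by move=> ne; apply: js => //; apply: contra ne => /eqP/wI->.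
have neB (i : 'I_c) : inl (i, true) != inl (i, false) :> slot c k by apply/eqP.
have ltT i : pair_time (time h) w i < size h by have [] := edge_at_time _ _ _ _ (jw _ _ (neB i)).
pose T := [ffun i => Ordinal (ltT i)].
have exV j : exists tb : 'I_(size h) * bool, endpoint (edge_at (edges h) tb.1) tb.2 = w (inr j) /\
    forall u' c', joined h c' (w (inr j)) u' -> tb.1 <= time h (w (inr j)) u'.
  (* The clique has at least two vertices, so each single vertex has an edge at it. *)
  have [b neb] : exists b : slot c k, inr j != b.
    apply/existsP; rewrite -[[exists _, _]]negbK negb_exists; apply/negP => /forallP H.
    move: m1; rewrite -cardI; apply/negP; rewrite -leqNgt; apply/fintype_le1P => x y.
    by have := H x; have := H y; rewrite !negbK => /eqP<- /eqP<-.
  exact: first_occurrence (jw _ _ neb).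
have [V hV] := fin_all_exists exV.
exists (T, finfun V); set L := spec _; set es := edges h.
have LV j : ((V j).1 : nat, (V j).2) \in L.
  by apply/codomP; exists (inr j); rewrite /= ffunE.
have LT i b : (pair_time (time h) w i, b) \in L.
  by apply/codomP; exists (inl (i, b)); rewrite /= ffunE.
have atT i : (edge_at es (pair_time (time h) w i) = (w (inl (i, true)), w (inl (i, false)))) \/
    (edge_at es (pair_time (time h) w i) = (w (inl (i, false)), w (inl (i, true)))).
  by have [] := edge_at_time _ _ _ _ (jw _ _ (neB i)).
have exposed_inr j t : (V j).1 <= t -> exposed L es t (w (inr j)).
  move=> le; apply/hasP; exists ((V j).1 : nat, (V j).2) => //=.
  by rewrite le /=; have [-> _] := hV j.
have exposed_inl i b t : pair_time (time h) w i <= t -> exposed L es t (w (inl (i, b))).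
  move=> le; apply/hasP; case: (atT i) => E.
    exists (pair_time (time h) w i, b); first exact: LT.
    by rewrite le E; case: (b); exact: eqxx.
  exists (pair_time (time h) w i, ~~ b); first exact: LT.
  by rewrite le E; case: (b); exact: eqxx.
(* Only clique vertices are ever exposed, so counted edges lie inside the clique and have its
   colour. *)
have exposedP t v : exposed L es t v -> v \in s.
  move=> /hasP[_ /codomP[[[i b]|j] ->] /= /andP[_ /eqP<-]].
    by rewrite ffunE; case: (atT i) => ->; case: b; exact: ws.
  by rewrite ffunE; have [-> _] := hV j.
split.
  apply/allP => t; rewrite mem_iota add0n => /= lt; apply/implyP => /andP[/exposedP us' /exposedP vs].
  apply/eqP; apply: (color_at h col (edge_at es t).1 (edge_at es t).2) => //.
    apply: js => //; have [|//] := lh t t; by rewrite leqnn.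
  exact: surjective_pairing.
pose tm a b := time h (w a) (w b).
have tm_lt a b : a != b -> tm a b < size h by move=> /jw/edge_at_time[].
have tm_at a b : a != b -> edge_at es (tm a b) = (w a, w b) \/ edge_at es (tm a b) = (w b, w a).
  by move=> /jw/edge_at_time[].
pose D := [set z : slot c k * slot c k | z.1 != z.2].
have cD : #|D| = (c.*2 + k) * (c.*2 + k).-1.
  rewrite (@card_set_pair _ _ (fun a b : slot c k => a != b) (c.*2 + k).-1) ?cardI // => a.
  rewrite -cardI -(cardsC1 a); congr #|pred_of_set _|; apply/setP => b.
  by rewrite !inE eq_sym.
pose G := [set z in D | counted L es (tm z.1 z.2)].
(* This says that the edge comes before the later of the two matching edges, so one of its ends may
   still be unknown. *)
pose late (x y : 'I_c * bool) :=
  tm (inl x) (inl y) < maxn (pair_time (time h) w x.1) (pair_time (time h) w y.1).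
pose W := [set z | (z.1.1 != z.2.1) && late z.1 z.2].
have cW : #|W| <= 2 * (c * c.-1).
  apply: card_wasted => x y ne; rewrite /late /= -!leqNgt => lt.
  have := opt2 x.1 x.2 y.1 y.2 ne; rewrite -!surjective_pairing leq_max leqNgt.
  by rewrite -/(tm _ _) lt.
have tmC a b : tm a b = tm b a by exact: timeC.
(* Edges at a single vertex count by [opt1] and the choice of [V], and matching edges count by
   themselves; what remains joins two pairs and satisfies [late]. *)
have DG : D :\: G \subset [set (inl z.1, inl z.2) | z in W].
  apply/subsetP => -[a b]; rewrite !inE /= andbC => /andP[ne]; rewrite ne /= => nc.
  have {nc} : ~~ (exposed L es (tm a b) (w a) && exposed L es (tm a b) (w b)).
    by apply: contra nc; rewrite /counted => /andP[ea eb]; case: (tm_at a b ne) => -> /=; rewrite ea eb.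
  have ok_r j b' : inr j != b' -> exposed L es (tm (inr j) b') (w (inr j)).
    by move=> ne'; apply: exposed_inr; have [_] := hV j; apply; apply: jw.
  case: a b ne => [x|j] [y|j'] ne.
  - move=> nc; apply/imsetP; exists (x, y) => //; rewrite inE /=; apply/andP; split.
      apply: contra nc => /eqP exy.
      have ey : y = (x.1, ~~ x.2).
        case: x y ne exy => [i b] [i' b'] /= ne e; rewrite -e; congr (_, _).
        by apply/eqP; move: ne; rewrite -e; case: b b' => [] [] //; rewrite eqxx.
      rewrite /tm ey [x in inl x]surjective_pairing -pair_timeE; last exact: timeC.
      by rewrite !exposed_inl.
    rewrite /late ltnNge geq_max; apply: contra nc => /andP[l1 l2].
    by case: x y l1 l2 {ne} => [i b] [i' b'] l1 l2; rewrite !exposed_inl.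
  - rewrite andbC tmC ok_r 1?eq_sym //= tmC => /negP[].
    by case: x ne => i b ne; apply: exposed_inl; exact: opt1.
  - rewrite ok_r //= tmC => /negP[].
    by case: y ne => i b ne; apply: exposed_inl; exact: opt1.
  - by rewrite ok_r //= tmC ok_r // eq_sym.
have cG : (c.*2 + k) * (c.*2 + k).-1 - 2 * (c * c.-1) <= #|G|.
  have GD : G \subset D by apply/subsetP => z; rewrite inE => /andP[].
  have cDG : #|D :\: G| <= 2 * (c * c.-1).
    apply: leq_trans (subset_leq_card DG) _.
    by apply: leq_trans (leq_imset_card _ _) _; rewrite ?cW.
  by have := cardsID G D; rewrite (setIidPr GD) cD; lia.
pose S := [set t : 'I_(size h) | counted L es t].
have cS : #|S| = ncounted L es.
  rewrite /ncounted size_map -val_enum_ord count_map cardE size_filter -enumT.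
  by apply: eq_count => t; rewrite /= inE.
(* The turn determines the edge and the boolean its orientation, so [G] has at most two elements per
   counted turn. *)
pose g (z : slot c k * slot c k) :=
  (insub (tm z.1 z.2) : option 'I_(size h), w z.1 == (edge_at es (tm z.1 z.2)).1).
have gE z : z \in G -> exists2 t : 'I_(size h), (g z).1 = Some t & val t = tm z.1 z.2.
  rewrite !inE => /andP[/tm_lt lt _] /=; case: insubP => [t _ vt|]; last by rewrite lt.
  by exists t.
have gI : {in G &, injective g}.
  move=> [a b] [a' b'] zG zG' e.
  have [t e1 v1] := gE _ zG; have [t' e2 v2] := gE _ zG'.
  have ett : t = t' by apply: Some_inj; rewrite -e1 -e2 e.
  have etm : tm a b = tm a' b' by rewrite -v1 -v2 ett.
  have e3 : (w a == (edge_at es (tm a' b')).1) = (w a' == (edge_at es (tm a' b')).1).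
    by move: (congr1 snd e); rewrite /= etm.
  move: zG zG'; rewrite !inE /= => /andP[ne _] /andP[ne' _].
  have := tm_at _ _ ne; rewrite etm; case: (tm_at _ _ ne') e3 => -> /= e3 [[/wI ea /wI eb]|[/wI ea /wI eb]].
  - by rewrite ea eb.
  - by move: e3; rewrite ea eqxx (inj_eq wI) => /eqP e3; rewrite e3 eqxx in ne.
  - by move: e3; rewrite ea eqxx (inj_eq wI) => /esym/eqP e3; rewrite e3 ea eqxx in ne'.
  - by rewrite ea eb.
have gS : g @: G \subset setX [set Some t | t in S] setT.
  apply/subsetP => _ /imsetP[z zG ->]; rewrite inE in_setT andbT.
  have [t -> vt] := gE _ zG; apply/imsetP; exists t => //.
  by move: zG; rewrite !inE vt => /andP[].
have := subset_leq_card gS; rewrite card_in_imset // cardsX cardsT card_bool -cS => lG.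
have lS : #|[set Some t | t in S]| <= #|S| by exact: leq_imset_card.
have := mul_bin_diag (c.*2 + k) 1; rewrite bin1; lia.
Qed.

(* Imported only here because its set notations hide those of [finset]. *)
From mathcomp Require Import all_classical all_reals all_analysis.
Import Order.TTheory GRing.Theory Num.Theory.
Local Open Scope ring_scope.

(** * Conditional expectations and Painter's strategy *)

Definition color_prob {R : realFieldType} (p : R) (col : bool) : R := if col then p else 1 - p.

(** An upper bound for the conditional probability, given [h], that a random
    Painter gives at least [K] counted edges, and all of them, the colour [col].
    From [K] counted edges on, the truncated exponent is [0]. *)
Definition weight {R : realFieldType} (p : R) (K : nat) (col : bool)
    (L : seq (nat * bool)) (h : history) : R :=
  if counted_mono L col h then color_prob p col ^+ (K - ncounted L (edges h)) else 0.

Lemma weight_ge0 {R : realFieldType} (p : R) K col L h : 0 <= p <= 1 -> 0 <= weight p K col L h.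
Proof.
move=> /andP[p0 p1]; rewrite /weight; case: ifP => // _; apply: exprn_ge0.
by case: col => //=; rewrite subr_ge0.
Qed.

(** An uncounted edge leaves the weight unchanged. For a counted edge only one colour survives, and
    its probability pays for the drop of the exponent; once the exponent is [0], it can only
    help. *)
Lemma weight_step {R : realFieldType} (p : R) K col L h e : 0 <= p <= 1 ->
  p * weight p K col L (rcons h (e, red)) + (1 - p) * weight p K col L (rcons h (e, blue))
  <= weight p K col L h.
Proof.
move=> hp; have w0 := weight_ge0 p K col L h hp; case/andP: hp => p0 p1.
have cE c : weight p K col L (rcons h (e, c)) =
    if counted_mono L col h && (counted L (rcons (edges h) e) (size h) ==> (c == col))
    then color_prob p col ^+ (K - (ncounted L (edges h) + counted L (rcons (edges h) e) (size h))) else 0.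
  by rewrite /weight counted_mono_rcons /edges map_rcons ncounted_rcons size_map.
rewrite !cE; move: w0; rewrite /weight; case: (counted_mono _ _ _) => /=; last by rewrite !mulr0 addr0.
case: (counted _ _ _) => /= w0; last by rewrite addn0 -mulrDl subrKC mul1r.
have q0 : 0 <= color_prob p col by case: (col) => //=; rewrite subr_ge0.
have q1 : color_prob p col <= 1 by case: (col) => //=; rewrite gerBl.
have -> : forall x : R, p * (if red == col then x else 0) + (1 - p) * (if blue == col then x else 0)
    = color_prob p col * x.
  by move=> x; case: (col) => /=; rewrite mulr0 ?addr0 ?add0r.
rewrite addn1; case: (ltnP (ncounted L (edges h)) K) => lt.
  by rewrite -exprS subnSK.
have /eqP -> : (K - (ncounted L (edges h)).+1 == 0)%N by rewrite subn_eq0 leqW.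
by move/eqP: lt => ->; rewrite mulr1.
Qed.

(** A union bound over all names. Names refer to all [N] turns of the game, also to those not yet
    played in [h]; [exposed] ignores entries from the future. *)
Definition total_weight {R : realFieldType} (p : R) (N c k : nat) (col : bool) (h : history) : R :=
  \sum_(TV : {ffun 'I_c -> 'I_N} * {ffun 'I_k -> 'I_N * bool})
    weight p ('C(c.*2 + k, 2) - c * c.-1) col (spec TV) h.

Lemma total_weight_step {R : realFieldType} (p : R) N c k col h e : 0 <= p <= 1 ->
  p * total_weight p N c k col (rcons h (e, red)) +
  (1 - p) * total_weight p N c k col (rcons h (e, blue)) <= total_weight p N c k col h.
Proof.
move=> hp; rewrite !mulr_sumr -big_split /=; apply: ler_sum => TV _; exact: weight_step.
Qed.

Lemma total_weight_nil {R : realFieldType} (p : R) N c k col :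
  total_weight p N c k col [::] =
  (N ^ c * (2 * N) ^ k)%:R * color_prob p col ^+ ('C(c.*2 + k, 2) - c * c.-1).
Proof.
rewrite /total_weight /weight /counted_mono /ncounted /= subn0 sumr_const.
rewrite card_prod !card_ffun card_prod !card_ord card_bool mulr_natl.
by rewrite [(2 * N)%N]mulnC.
Qed.

(** The name given by [clique_spec] alone has weight [1], as its truncated exponent is [0]. *)
Lemma clique_total_weight {R : realFieldType} (p : R) N c k col h :
  0 <= p <= 1 -> legal_history h -> size h = N -> (1 < c.*2 + k)%N ->
  has_mono_clique h col (c.*2 + k) -> 1 <= total_weight p N c k col h.
Proof.
move=> hp lh <- m1 /(clique_spec h col c k lh m1)[TV [mono le]].
rewrite /total_weight (bigD1 TV) //= {1}/weight mono.
have /eqP -> : ('C(c.*2 + k, 2) - c * c.-1 - ncounted (spec TV) (edges h) == 0)%N by rewrite subn_eq0.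
rewrite expr0 lerDl; apply: sumr_ge0 => ? _; exact: weight_ge0.
Qed.

(** Painter keeps the sum of the red and blue total weights from growing. It starts below [1], while
    a clique at the end would make one summand at least [1]. *)
Lemma not_builder_guarantees {R : realFieldType} (p : R) (n N c k : nat) :
  0 <= p <= 1 -> (1 < c.*2 + k)%N -> (1 < n)%N ->
  (N ^ c * (2 * N) ^ k)%:R * p ^+ ('C(c.*2 + k, 2) - c * c.-1) +
  ((2 * N) ^ n)%:R * (1 - p) ^+ 'C(n, 2) < 1 ->
  ~ builder_guarantees (c.*2 + k) n N.
Proof.
move=> hp m1 n1 lt1 [B legB win].
pose pot h : R := total_weight p N c k red h + total_weight p N 0 n blue h.
pose P : painter_strategy := fun h e => pot (rcons h (e, red)) <= pot h.
have pot_step h e : pot (rcons h (e, P h e)) <= pot h.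
  rewrite /P; have [//|gt] := boolP (pot (rcons h (e, red)) <= pot h); move: gt; rewrite -ltNge => gt.
  have := total_weight_step p N c k red h e hp.
  have := total_weight_step p N 0 n blue h e hp.
  move: gt; rewrite /pot; case/andP: hp => p0 p1.
  set a := total_weight p N c k red h; set b := total_weight p N 0 n blue h.
  set a1 := total_weight _ _ _ _ _ (rcons h (e, red)).
  set b1 := total_weight _ _ _ _ _ (rcons h (e, red)).
  set a0 := total_weight _ _ _ _ _ (rcons h (e, blue)).
  set b0 := total_weight _ _ _ _ _ (rcons h (e, blue)).
  move=> gt le1 le2.
  have sum_le : p * (a1 + b1) + (1 - p) * (a0 + b0) <= a + b by lra.
  have le3 : p * (a + b) <= p * (a1 + b1) by apply: ler_wpM2l => //; exact: ltW.
  (* At [p = 1] the averaged inequality contradicts the growth under red; otherwise dividing by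
     [1 - p] shows that blue does not increase the sum. *)
  move: p1; rewrite le_eqVlt => /orP[/eqP pE|p1]; first by exfalso; rewrite pE in sum_le; lra.
  have p1' : 0 < 1 - p by rewrite subr_gt0.
  by rewrite -(ler_pM2l p1'); lra.
have pot_play t : pot (play B P t) <= pot [::].
  by elim: t => //= t IH; apply: le_trans IH; exact: pot_step.
have lt_pot : pot (play B P N) < 1.
  apply: le_lt_trans (pot_play N) _.
  by rewrite /pot !total_weight_nil /= mul1n subn0.
have ge0 c' k' col : 0 <= total_weight p N c' k' col (play B P N).
  by apply: sumr_ge0 => ? _; exact: weight_ge0.
have lh := legal_play B P N legB; have sz := size_play B P N.
move: lt_pot; rewrite ltNge => /negP; apply.
case: (win P) => [cl|cl].
  by apply: le_trans (clique_total_weight p N c k red _ hp lh sz m1 cl) _; rewrite lerDl.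
by apply: le_trans (clique_total_weight p N 0 n blue _ hp lh sz n1 cl) _; rewrite lerDr.
Qed.

(** * Numerical estimates for the two colours *)

(** With [a = 4 * j.+1], [expR (y / 4)] is the power [j.+1] of [expR (y / a)], hence at least
    [(y / a) ^+ j.+1]; one factor [y] absorbs [8 * a ^+ j.+1]. *)
Lemma expR_gt_pow {R : realType} (j : nat) (y : R) :
  8 * (4 * j.+1%:R) ^+ j.+1 <= y -> 8 * y ^+ j <= expR (y / 4).
Proof.
move=> hy; set a : R := 4 * j.+1%:R in hy *.
have a0 : 0 < a by rewrite mulr_gt0 // ltr0n.
have y0 : 0 <= y by apply: le_trans hy; rewrite mulr_ge0 // exprn_ge0 // ltW.
have -> : y / 4 = y / a * j.+1%:R.
  by rewrite /a; field; rewrite nat1r pnatr_eq0.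
rewrite expRM_natr.
have le1 : y / a <= expR (y / a) by have := expR_ge1Dx (y / a); lra.
have le2 : (y / a) ^+ j.+1 <= expR (y / a) ^+ j.+1.
  by rewrite lerXn2r // ?nnegrE ?expR_ge0 // divr_ge0 // ltW.
apply: le_trans le2; rewrite expr_div_n exprS [y * _]mulrC -mulrA mulrC ler_wpM2l ?exprn_ge0 //.
by rewrite ler_pdivlMr ?exprn_gt0.
Qed.

(** Bounds the exponent of [n] in the red term. The quadratic terms cancel up to a square at most
    [1], leaving at most [2 * c - 2 * M + 1 / 2]; then [2 * c <= M] and [3 <= M] suffice. *)
Lemma exponent_bound {R : realType} (s M c K : R) :
  0 <= s -> s ^+ 2 = 2 -> 3 <= M -> 0 <= c ->
  c <= (1 - s / 2) * M < c + 1 ->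
  M * (M - 1) / 2 - c * (c - 1) <= K <= M * (M - 1) / 2 ->
  ((2 - s) * M - 3) * (M - c) + (M^-1 - 1) * K <= - 1.
Proof.
move=> s0 s2 M3 c0 /andP[lc uc] /andP[lK uK].
have s1 : 1 <= s by nra.
have cM : 2 * c <= M by nra.
have KM : M^-1 * K <= (M - 1) / 2.
  by rewrite mulrC ler_pdivrMr; lra.
have sq : ((1 - s / 2) * M - c) ^+ 2 <= 1 by nra.
(* [1 - s / 2] is the critical ratio [c / M], whence the square. *)
have E : (2 - s) * M * (M - c) = M ^+ 2 / 2 - c ^+ 2 + ((1 - s / 2) * M - c) ^+ 2.
  have -> : M ^+ 2 / 2 - c ^+ 2 + ((1 - s / 2) * M - c) ^+ 2 =
    (3 / 2 - s + s ^+ 2 / 4) * M ^+ 2 - (2 - s) * M * c by field.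
  by rewrite s2; field.
rewrite mulrBl E; nra.
Qed.

Lemma natr_bin2 {R : realType} (n : nat) : ('C(n, 2)%:R : R) = n%:R * (n%:R - 1) / 2.
Proof.
case: n => [|n]; first by rewrite !mul0r.
have := mul_bin_diag n.+1 1; rewrite bin1 => /(congr1 (fun x => x%:R : R)).
by rewrite !natrM -[in n.+1%:R - 1]natr1 addrK => ->; field.
Qed.

(** The powers of [n] contribute at most [n^-1] and the factor [2 ^ k] at most [2 ^ m], which
    [2 ^ m.+2 <= n] turns into [1 / 4]. *)
Lemma red_bound {R : realType} (n N c k : nat) :
  let m := (c.*2 + k)%N in
  let b : R := (2 - Num.sqrt (2 : R)) * m%:R - 3 in
  (3 <= m)%N -> (2 ^ m.+2 <= n)%N ->
  (c%:R : R) <= (1 - Num.sqrt (2 : R) / 2) * m%:R < c%:R + 1 ->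
  N%:R <= (n%:R : R) `^ b ->
  (N ^ c * (2 * N) ^ k)%:R * ((n%:R : R) `^ (m%:R^-1 - 1)) ^+ ('C(m, 2) - c * c.-1) <= 4^-1.
Proof.
move=> m b m3 nm hc hN.
have n0 : (0 : R) < n%:R by rewrite ltr0n; apply: leq_trans nm; rewrite expn_gt0.
have n1 : (1 : R) <= n%:R by rewrite ler1n; apply: leq_trans nm; rewrite expn_gt0.
set K := ('C(m, 2) - c * c.-1)%N.
have E : ((N ^ c * (2 * N) ^ k)%:R : R) = 2 ^+ k * N%:R ^+ (c + k).
  by rewrite natrM !natrX natrM exprMn exprD; ring.
have le1 : N%:R ^+ (c + k) <= (n%:R : R) `^ (b * (c + k)%:R).
  by rewrite powRrM powR_mulrn ?powR_ge0 // lerXn2r ?nnegrE ?powR_ge0.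
have KC : K%:R <= 'C(m, 2)%:R :> R by rewrite ler_nat leq_subr.
have cc : (c * c.-1)%:R = c%:R * (c%:R - 1) :> R.
  by case: (c) => [|c']; rewrite ?mul0r // natrM /= -[c'.+1]addn1 natrD addrK.
have CK : 'C(m, 2)%:R - c%:R * (c%:R - 1) <= K%:R :> R.
  by rewrite -cc lerBlDr -natrD ler_nat /K; lia.
have ex : b * (c + k)%:R + (m%:R^-1 - 1) * K%:R <= - 1.
  have -> : ((c + k)%:R : R) = m%:R - c%:R by rewrite /m -addnn !natrD; ring.
  apply: (@exponent_bound R (Num.sqrt 2)); rewrite ?sqrtr_ge0 ?sqr_sqrtr ?ler_nat //.
  by rewrite -natr_bin2 CK KC.
rewrite E -[(_ `^ _) ^+ K]powR_mulrn ?powR_ge0 // -powRrM.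
apply: (@le_trans _ _ (2 ^+ m * (n%:R `^ (b * (c + k)%:R) * n%:R `^ ((m%:R^-1 - 1) * K%:R)))).
  rewrite -mulrA ler_pM ?exprn_ge0 ?mulr_ge0 ?powR_ge0 ?exprn_ge0 //.
    by rewrite ler_eXn2l ?ltr1n // /m leq_addl.
  by rewrite ler_wpM2r ?powR_ge0.
rewrite -powRD; last by rewrite (gt_eqF n0) implybT.
apply: (@le_trans _ _ (2 ^+ m * n%:R^-1)).
  by rewrite ler_wpM2l ?exprn_ge0 // -[leRHS]powR_inv1 ?ler0n // ler_powR.
rewrite ler_pdivrMr // -ler_pdivrMl // invrK.
by rewrite -natrX -natrM ler_nat; apply: leq_trans nm; rewrite !expnS; lia.
Qed.

(** Everything is bounded by an [n]-th power: [2 * N] is at most [2 * y ^+ (m * m)], and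
    [1 - y / n <= expR (- (y / n))] gives [expR (- (y / 4))] per vertex. *)
Lemma blue_bound {R : realType} (m n N : nat) (y : R) :
  (0 < m)%N -> (1 < n)%N -> y ^+ m = n%:R ->
  8 * (4 * (m * m).+1%:R) ^+ (m * m).+1 <= y -> y <= n%:R ->
  N%:R <= (n%:R : R) ^+ m ->
  ((2 * N) ^ n)%:R * (1 - y / n%:R) ^+ 'C(n, 2) <= 4^-1.
Proof.
move=> m0 n1 yn hy yn' hN.
have y0 : 0 <= y by apply: le_trans hy; rewrite mulr_ge0 // exprn_ge0 // mulr_ge0.
have n0 : (0 : R) < n%:R by rewrite ltr0n ltnW.
have p1 : y / n%:R <= 1 by rewrite ler_pdivrMr // mul1r.
have le1 : (1 - y / n%:R) ^+ 'C(n, 2) <= expR (- (y / 4)) ^+ n.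
  apply: (@le_trans _ _ (expR (- (y / n%:R)) ^+ 'C(n, 2))).
    rewrite lerXn2r ?nnegrE ?subr_ge0 ?expR_ge0 //.
    exact: expR_ge1Dx.
  rewrite -!expRM_natr ler_expR natr_bin2.
  have -> : - (y / n%:R) * (n%:R * (n%:R - 1) / 2) = - (y * (n%:R - 1) / 2).
    by field; rewrite gt_eqF.
  have : (2 : R) <= n%:R by rewrite (ler_nat R 2 n).
  nra.
have le2 : ((2 * N) ^ n)%:R <= (2 * y ^+ (m * m)) ^+ n :> R.
  by rewrite natrX lerXn2r ?nnegrE ?mulr_ge0 ?exprn_ge0 // natrM ler_wpM2l // exprM yn.
apply: (@le_trans _ _ ((2 * y ^+ (m * m)) ^+ n * expR (- (y / 4)) ^+ n)).
  by rewrite ler_pM ?exprn_ge0 // subr_ge0.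
rewrite -exprMn.
have le3 : 2 * y ^+ (m * m) * expR (- (y / 4)) <= 4^-1.
  rewrite expRN ler_pdivrMr ?expR_gt0 //.
  have := expR_gt_pow (m * m) y hy; lra.
apply: (@le_trans _ _ (4^-1 ^+ n)).
  by rewrite lerXn2r ?nnegrE // ?mulr_ge0 ?exprn_ge0 ?expR_ge0 // invr_ge0.
by rewrite -[leRHS]expr1 ler_wiXn2l ?invf_le1 ?ler1n // ltnW.
Qed.

(** * Choice of the parameters and the lower bound *)

Theorem corollary3 (R : realType) :
  exists C : R, forall m : nat, (3 <= m)%N ->
    exists n0 : nat, forall n : nat, (n0 <= n)%N ->
      (n%:R : R) `^ ((2 - Num.sqrt 2) * m%:R - C) <= (online_ramsey m n)%:R.
Proof.
exists 3 => m m3; pose j := (m * m)%N.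
(* The first summand serves [red_bound]; the second makes [n ^ (1 / m)] large enough for
   [blue_bound]. *)
exists (2 ^ m.+2 + (8 * (4 * j.+1) ^ j.+1) ^ m)%N => n hn.
have n4 : (2 ^ m.+2 <= n)%N by lia.
have n1 : (1 < n)%N by apply: leq_trans n4; rewrite expnS; have := expn_gt0 2 m.+1; lia.
rewrite leNgt; apply/negP => /ltW hN; set N := online_ramsey m n in hN.
have won : builder_guarantees m n N.
  by rewrite /N /online_ramsey; case: ex_minnP => t /asboolP.
have nR0 : (0 : R) < n%:R by rewrite ltr0n ltnW.
have nR1 : (1 : R) <= n%:R by rewrite ler1n ltnW.
have mR3 : (3 : R) <= m%:R by rewrite (ler_nat R 3 m).
have s0 : 0 <= Num.sqrt (2 : R) by exact: sqrtr_ge0.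
have s2 : Num.sqrt (2 : R) ^+ 2 = 2 by rewrite sqr_sqrtr.
have s1 : 1 <= Num.sqrt (2 : R) <= 2 by nra.
pose x : R := (1 - Num.sqrt (2 : R) / 2) * m%:R.
have x0 : 0 <= x by apply: mulr_ge0; lra.
(* [c] is the integer part of the real optimum [x], since [1 - sqrt 2 / 2] equals
   [1 - 1 / sqrt 2]. *)
have [c hc] : exists c : nat, c%:R <= x < c%:R + 1.
  by exists (Num.truncn x); have := truncn_itv x0; rewrite -natr1.
have cm : (c.*2 <= m)%N.
  rewrite -(ler_nat R) -mul2n natrM; move: hc => /andP[hc _]; rewrite /x in hc; nra.
pose k := (m - c.*2)%N; have mE : m = (c.*2 + k)%N by rewrite subnKC.
pose y : R := n%:R `^ m%:R^-1.
have ym : y ^+ m = n%:R.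
  by rewrite -powR_mulrn ?powR_ge0 // -powRrM mulVf ?powRr1 ?ler0n // gt_eqF; lra.
have yn : y <= n%:R.
  rewrite -[leRHS]powRr1 ?ler0n // ler_powR // invf_le1; lra.
have pE : n%:R `^ (m%:R^-1 - 1) = y / n%:R :> R.
  by rewrite powRB ?powRr1 ?ler0n // (gt_eqF nR0) implybT.
have hy : 8 * (4 * (m * m).+1%:R) ^+ (m * m).+1 <= y.
  rewrite -(@ler_pXn2r _ m) ?nnegrE ?powR_ge0 ?mulr_ge0 ?exprn_ge0 ?mulr_ge0 //; last by lia.
  rewrite ym -natrM -natrX -natrM -natrX ler_nat -/j; lia.
(* The exponent is at most [m]; this crude bound is enough for blue. *)
have hNm : N%:R <= (n%:R : R) ^+ m.
  by apply: le_trans hN _; rewrite -powR_mulrn ?ler0n // ler_powR //; nra.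
move: won; rewrite {1}mE.
apply: (@not_builder_guarantees R (y / n%:R)) => //.
- by rewrite divr_ge0 ?powR_ge0 ?ler0n //= ler_pdivrMr // mul1r.
- by rewrite -mE; lia.
rewrite -pE; have := blue_bound m n N y _ n1 ym hy yn hNm; rewrite -pE => /(_ (ltnW (ltnW m3))) leb.
have := @red_bound R n N c k; rewrite /= -mE => /(_ m3 n4 hc hN) ler.
lra.
Qed.
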